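(* (1) Let $\mathcal{G}$ be a switched affine system model and $\bar{\mathcal{G}}_i$ a fault model such that the pair $(\mathcal{G},\bar{\mathcal{G}}_i)$ is $T_i$-distinguishable. Then the detection delay of fault $\bar{\mathcal{G}}_i$ under the receding-horizon fault detection scheme described in the context is at most $T_i$. (2) Let $(\bar{\mathcal{G}}_i,\bar{\mathcal{G}}_j)$ be a pair of fault models that is $I_{i,j}$-isolable (i.e. $I_{i,j}$-distinguishable). Then the isolation delay for this pair is at most $I_{i,j}$.
   Context: SWA model: $\mathcal{G}=(\mathcal{X},\mathcal{E},\mathcal{U},\{G_i\}_{i=1}^m)$, where $\mathcal{X}\subset\mathbb{R}^n$ (states), $\mathcal{E}\subset\mathbb{R}^{n_y+n}$ (measurement noise $\boldsymbol{\eta}\in\mathbb{R}^{n_y}$ stacked with process noise $\boldsymbol{\nu}\in\mathbb{R}^{n}$) and $\mathcal{U}\subset\mathbb{R}^{n_u}$ (inputs) are convex and compact, of the form $\mathcal{X}=\{\mathbf{x}: P\mathbf{x}\le p\}$, $\mathcal{E}=\{\|\boldsymbol{\eta}\|\le\epsilon_\eta,\|\boldsymbol{\nu}\|\le\epsilon_\nu\}$, $\mathcal{U}=\{\|\mathbf{u}\|\le U\}$ (infinity norms), and each mode $G_i=\{\mathbf{A}_i,\mathbf{B}_i,\mathbf{C}_i,\mathbf{D}_i,\mathbf{f}_i,\mathbf{g}_i\}$ consists of real matrices and vectors of compatible dimensions. The evolution is $$\mathbf{x}_{t+1}=\mathbf{A}_{\sigma_t}\mathbf{x}_t+\mathbf{B}_{\sigma_t}\mathbf{u}_t+\mathbf{f}_{\sigma_t}+\boldsymbol{\nu}_t,\qquad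 \mathbf{y}_t=\mathbf{C}_{\sigma_t}\mathbf{x}_t+\mathbf{D}_{\sigma_t}\mathbf{u}_t+\mathbf{g}_{\sigma_t}+\boldsymbol{\eta}_t,$$ with active mode $\sigma_t\in\{1,\dots,m\}$. A fault model for $\mathcal{G}$ is another SWA model with the same numbers of states, inputs and outputs. Length-$N$ behavior: $\mathcal{B}^N_{swa}(\mathcal{G})$ is the set of all sequences $\{\mathbf{u}_t,\mathbf{y}_t\}_{t=0}^{N-1}$ with $\mathbf{u}_t\in\mathcal{U}$ for which there exist $\mathbf{x}_t\in\mathcal{X}$, $\sigma_t\in\{1,\dots,m\}$, $[\boldsymbol{\eta}_t^\intercal\ \boldsymbol{\nu}_t^\intercal]^\intercal\in\mathcal{E}$ for $t=0,\dots,N-1$ such that the evolution equations hold for $t=0,\dots,N-1$ (the state $\mathbf{x}_N$ is any vector of $\mathbb{R}^n$, not required to lie in $\mathcal{X}$). Membership of a window $\{\mathbf{u}_k,\mathbf{y}_k\}_{k=a}^{a+N-1}$ in $\mathcal{B}^N_{swa}$ is understood after shifting its time index to start at $0$. $T$-distinguishability: two SWA models are $T$-distinguishable if their length-$T$ behaviors are disjoint. Data: an input-output signal $\{\mathbf{u}_t,\mathbf{y}_t\}$ is observed (with enough past samples available to fill the windows used below). Fault $i$ occurs at time $t^*$ and is persistent: every window of the signal of length $L$ contained in times $\ge t^*$ lies in $\mathcal{B}^L_{swa}(\bar{\mathcal{G}}_i)$, and every window of length $L$ contained in times $<t^*$ lies in $\mathcal{B}^L_{swa}(\mathcal{G})$.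 Detection scheme: at each time $t$ the scheme declares a fault if and only if the window $\{\mathbf{u}_k,\mathbf{y}_k\}_{k=t-T+1}^{t}$ is not in $\mathcal{B}^T_{swa}(\mathcal{G})$ (model invalidation), where the horizon $T$ is the maximum over all fault models $\bar{\mathcal{G}}_j$ under consideration of integers $T_j$ for which $(\mathcal{G},\bar{\mathcal{G}}_j)$ is $T_j$-distinguishable; in particular $T\ge T_i$. Isolation for a pair $(\bar{\mathcal{G}}_i,\bar{\mathcal{G}}_j)$: model invalidation is run for both fault models on the receding window of the last $I_{i,j}$ samples; the occurred fault $i$ is isolated from $j$ at time $t$ if this window is in the behavior of $\bar{\mathcal{G}}_i$ and not in that of $\bar{\mathcal{G}}_j$. Delays: the detection (respectively isolation) delay is the number of time samples from the occurrence of the fault to its detection (respectively isolation); that is, if the first time $t\ge t^*$ of detection (isolation) is $t'$, the delay is $t'-t^*+1$. *)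

(* Defs.v *)
From HB Require Import structures.
From mathcomp Require Export all_boot all_order all_algebra.
From mathcomp Require Export boolp classical_sets reals topology normedtype.
Export numFieldNormedType.Exports.

Set Implicit Arguments.
Unset Strict Implicit.
Unset Printing Implicit Defensive.

Local Open Scope classical_set_scope.
Local Open Scope ring_scope.

Record mode (R : realType) (n nu ny : nat) := Mode {
  mA : 'M[R]_(n, n);
  mB : 'M[R]_(n, nu);
  mC : 'M[R]_(ny, n);
  mD : 'M[R]_(ny, nu);
  mf : 'cV[R]_n;
  mg : 'cV[R]_ny
}.

Definition polyhedron (R : realType) (q n : nat) (P : 'M[R]_(q, n))
    (p : 'cV[R]_q) : set 'cV[R]_n :=
  [set x | forall k : 'I_q, (P *m x) k 0 <= p k 0].

(* Switched affine models with n states, nu inputs and ny outputs.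
   Convexity of the state, input and noise sets, and compactness of the last
   two, are automatic from their form; only boundedness of the state
   polyhedron is an actual constraint. *)
Record swa (R : realType) (n nu ny : nat) := Swa {
  swa_rows : nat;
  swa_P : 'M[R]_(swa_rows, n);
  swa_p : 'cV[R]_swa_rows;
  swa_compact : compact (polyhedron swa_P swa_p);
  swa_eps_eta : R;
  swa_eps_nu : R;
  swa_Ubound : R;
  swa_m : nat;
  swa_mode : 'I_swa_m -> mode R n nu ny
}.

Unset Implicit Arguments.

Definition stateset {R : realType} {n nu ny : nat} (G : swa R n nu ny) :
    set 'cV[R]_n := polyhedron (swa_P G) (swa_p G).

(* The norm `|x| of a matrix is the maximum of the absolute values of its
   entries, i.e. the infinity norm. *)
Definition noiseset {R : realType} {n nu ny : nat} (G : swa R n nu ny) :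
    set 'cV[R]_(ny + n) :=
  [set e | `|usubmx e| <= swa_eps_eta G /\ `|dsubmx e| <= swa_eps_nu G].

Definition inputset {R : realType} {n nu ny : nat} (G : swa R n nu ny) :
    set 'cV[R]_nu := [set u | `|u| <= swa_Ubound G].

Definition signal (R : realType) (nu ny : nat) : Type :=
  nat -> 'cV[R]_nu * 'cV[R]_ny.

Definition io_seq (R : realType) (nu ny N : nat) : Type :=
  'I_N -> 'cV[R]_nu * 'cV[R]_ny.

(* The state sequence is indexed by nat, but only its values at 0, ..., N are
   constrained, and its value at N need not belong to the state set. *)
Definition behavior {R : realType} {n nu ny : nat} (N : nat)
    (G : swa R n nu ny) : set (io_seq R nu ny N) :=
  [set w | exists (x : nat -> 'cV[R]_n) (sigma : 'I_N -> 'I_(swa_m G))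
             (eta : 'I_N -> 'cV[R]_ny) (v : 'I_N -> 'cV[R]_n),
     forall t : 'I_N,
       let u := (w t).1 in
       let y := (w t).2 in
       let M := swa_mode (sigma t) in
       [/\ inputset G u,
           stateset G (x t),
           noiseset G (col_mx (eta t) (v t)),
           x t.+1 = mA M *m x t + mB M *m u + mf M + v t &
           y = mC M *m x t + mD M *m u + mg M + eta t]].

Definition distinguishable {R : realType} {n nu ny : nat} (T : nat)
    (G1 G2 : swa R n nu ny) : Prop :=
  behavior T G1 `&` behavior T G2 = set0.

(* The samples at times a, ..., a + N - 1, reindexed from 0. *)
Definition window {R : realType} {nu ny : nat} (s : signal R nu ny)
    (a N : nat) : io_seq R nu ny N :=
  fun k => s (a + k)%N.

(* The N most recent samples at time t, i.e. those at times t - N + 1, ..., t;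
   meaningful only when N <= t + 1, since subtraction is truncated. *)
Definition last_window {R : realType} {nu ny : nat} (s : signal R nu ny)
    (t N : nat) : io_seq R nu ny N :=
  window s (t.+1 - N) N.

Definition fault_occurs {R : realType} {n nu ny : nat} (s : signal R nu ny)
    (G Gfault : swa R n nu ny) (tstar : nat) : Prop :=
  (forall a L : nat, (tstar <= a)%N -> behavior L Gfault (window s a L)) /\
  (forall a L : nat, (a + L <= tstar)%N -> behavior L G (window s a L)).

(* No fault is declared or isolated before enough samples fill the window. *)
Definition detects {R : realType} {n nu ny : nat} (s : signal R nu ny)
    (G : swa R n nu ny) (T t : nat) : Prop :=
  (T <= t.+1)%N /\ ~ behavior T G (last_window s t T).

Definition isolates {R : realType} {n nu ny : nat} (s : signal R nu ny)
    (Gi Gj : swa R n nu ny) (I t : nat) : Prop :=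
  [/\ (I <= t.+1)%N,
      behavior I Gi (last_window s t I) &
      ~ behavior I Gj (last_window s t I)].

(* d is the delay, from time tstar, of an event occurring at the times t
   satisfying E; the sample at tstar is counted. *)
Definition is_delay (E : nat -> Prop) (tstar d : nat) : Prop :=
  exists t' : nat,
    [/\ (tstar <= t')%N, E t',
        forall t : nat, (tstar <= t < t')%N -> ~ E t &
        d = (t' - tstar + 1)%N].

(* Main.v *)
Require Import Defs.

(* At time tstar + N - 1 the last N samples are exactly the first N samples of
   the fault, so N-distinguishability excludes the competing model.  For
   detection the horizon T may exceed N; but a length-T behavior of G restricts
   to a length-N behavior on the final N samples. *)

(** Shifting every witness by [k] suffices: the state after the last retained sample still obeys the
    dynamics, and nothing else is asked of it. *)
Lemma behavior_subwindow {R : realType} {n nu ny : nat} {G : swa R n nu ny}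
    {s : signal R nu ny} {a : nat} (k M N : nat) :
  (k + M <= N)%N -> behavior N G (window s a N) ->
  behavior M G (window s (a + k) M).
Proof.
move=> kMN [x [sigma [eta [v bG]]]].
have ltN (t : 'I_M) : (k + t < N)%N.
  by rewrite (leq_trans _ kMN)// ltn_add2l.
exists (fun t => x (k + t)%N), (fun t => sigma (Ordinal (ltN t))),
  (fun t => eta (Ordinal (ltN t))), (fun t => v (Ordinal (ltN t))) => t.
by have := bG (Ordinal (ltN t)); rewrite /window /= addnA addnS.
Qed.

Lemma behavior0 {R : realType} {n nu ny : nat} {G : swa R n nu ny}
    (w : io_seq R nu ny 0) : behavior 0 G w.
Proof.
(* [G] may have no modes at all, so the mode sequence is drawn from the emptiness of ['I_0]. *)
by exists (fun=> 0%R), (fun t : 'I_0 => match notF (valP t) with end),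
  (fun=> 0%R), (fun=> 0%R) => -[].
Qed.

(** The empty sequence lies in both length-0 behaviors, so horizon 0 never distinguishes. *)
Lemma distinguishable_gt0 {R : realType} {n nu ny N : nat}
    {G1 G2 : swa R n nu ny} : distinguishable N G1 G2 -> (0 < N)%N.
Proof.
case: N => // /seteqP[+ _] => /(_ (fun=> (0%R, 0%R))).
by case; split; exact: behavior0.
Qed.

Lemma distinguishable_notin {R : realType} {n nu ny N : nat}
    {G1 G2 : swa R n nu ny} {w : io_seq R nu ny N} :
  distinguishable N G1 G2 -> behavior N G1 w -> ~ behavior N G2 w.
Proof. by move=> /seteqP[sub0 _] G1w G2w; exact: (sub0 w). Qed.

Lemma distinguishable_sym {R : realType} {n nu ny N : nat}
    {G1 G2 : swa R n nu ny} :
  distinguishable N G1 G2 -> distinguishable N G2 G1.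
Proof. by rewrite /distinguishable setIC. Qed.

(** The first occurrence exists by well-ordering and comes no later than [tstar + N - 1]; counting
    the sample at [tstar] turns this into a delay of at most [N]. *)
Lemma is_delay_le (E : nat -> Prop) (tstar N : nat) :
  (0 < N)%N -> E (tstar + N).-1 ->
  exists d : nat, is_delay E tstar d /\ (d <= N)%N.
Proof.
case: N => // N _; rewrite addnS /= => EN.
have exE : exists t, (tstar <= t)%N && `[< E t >].
  by exists (tstar + N)%N; rewrite leq_addr; exact/asboolP.
case: (ex_minnP exE) => t' /andP[le_t' /asboolP Et'] min_t'.
exists (t' - tstar + 1)%N; split; last first.
  by rewrite addn1 ltnS leq_subLR min_t'// leq_addr; exact/asboolP.
exists t'; split=> // t /andP[le_t lt_t'] Et.
by move: lt_t'; rewrite ltnNge min_t'// le_t; exact/asboolP.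
Qed.

Theorem proposition3 (R : realType) (n nu ny : nat) (G : swa R n nu ny)
    (nf : nat) (Gf : 'I_nf -> swa R n nu ny) :
  (forall Td : 'I_nf -> nat,
     (forall j : 'I_nf, distinguishable (Td j) G (Gf j)) ->
     forall (i : 'I_nf) (s : signal R nu ny) (tstar : nat),
       fault_occurs s G (Gf i) tstar ->
       ((\max_(j < nf) Td j)%N <= tstar.+1)%N ->
       exists d : nat,
         is_delay (detects s G (\max_(j < nf) Td j)%N) tstar d /\
         (d <= Td i)%N)
  /\
  (forall (i j : 'I_nf) (I : nat),
     distinguishable I (Gf i) (Gf j) ->
     forall (s : signal R nu ny) (tstar : nat),
       fault_occurs s G (Gf i) tstar ->
       exists d : nat,
         is_delay (isolates s (Gf i) (Gf j) I) tstar d /\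
         (d <= I)%N).
Proof.
split=> [Td distT i s tstar [postf _] leT | i j I distI s tstar [postf _]].
- have Ti_gt0 := distinguishable_gt0 (distT i).
  apply: is_delay_le => //; set T := (\max_(j < nf) Td j)%N in leT *.
  have leTi : (Td i <= T)%N by exact: leq_bigmax.
  (* The horizon window is already filled at time [tstar + Td i - 1], so its truncated starting
     index is exact. *)
  have leTt : (T <= tstar + Td i)%N.
    by rewrite (leq_trans leT)// -addn1 leq_add2l.
  have tK : (tstar + Td i).-1.+1 = (tstar + Td i)%N.
    by rewrite prednK// addn_gt0 Ti_gt0 orbT.
  rewrite /detects /last_window tK; split=> // bG.
  have := distinguishable_sym (distT i).
  move=> /distinguishable_notin/(_ (postf tstar (Td i) (leqnn _))); apply.
  (* Dropping the oldest [T - Td i] samples leaves a window starting at [tstar], made of faulty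
     samples only. *)
  have := behavior_subwindow (T - Td i) (Td i) T _ bG.
  rewrite subnK// => /(_ (leqnn _)).
  by rewrite addnBA// subnK// addnK.
- have I_gt0 := distinguishable_gt0 distI.
  apply: is_delay_le => //.
  have tK : (tstar + I).-1.+1 = (tstar + I)%N.
    by rewrite prednK// addn_gt0 I_gt0 orbT.
  have bGi := postf tstar I (leqnn _).
  rewrite /isolates /last_window tK addnK leq_addl; split=> //.
  exact: distinguishable_notin distI bGi.
Qed.
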